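(* $$\operatorname{gr}_4(P_5:PA_{7,5})=26 .$$
   Context: All graphs are finite, simple and undirected. $K_n$ is the complete graph on $n$ vertices and $P_5$ is the path with $5$ vertices and $4$ edges. For $t\geq\omega+1$, the pineapple $PA_{t,\omega}$ is the graph of order $t$ obtained from the complete graph $K_\omega$ by attaching $t-\omega$ pendent vertices to one and the same vertex of $K_\omega$; thus $PA_{7,5}$ is $K_5$ with two pendent vertices attached to the same vertex. A $k$-edge-coloring assigns to each edge one of $k$ colors; all $k$-edge-colorings are assumed exact, i.e. each of the $k$ colors is used at least once. An edge-colored graph is rainbow if all its edges have different colors and monochromatic if all its edges have a single color. A copy of a graph means a (not necessarily induced) subgraph isomorphic to it. For non-empty graphs $G,H$ (graphs with at least one edge) and a positive integer $k$, the Gallai-Ramsey number $\operatorname{gr}_k(G:H)$ is the minimum integer $N$ with $\binom{N}{2}\geq k$ (so that $K_N$ admits a $k$-edge-coloring) such that for all $n\geq N$, every $k$-edge-coloring of $K_n$ contains either a rainbow copy of $G$ or a monochromatic copy of $H$. *)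

(* Defs.v *)
From mathcomp Require Import all_boot.

Set Implicit Arguments.
Unset Strict Implicit.
Unset Printing Implicit Defensive.

Record sgraph := SGraph {
  vertex :> finType;
  adj : rel vertex;
  adj_sym : symmetric adj;
  adj_irrefl : irreflexive adj
}.

Definition edges (G : sgraph) : {set {set G}} :=
  [set [set p.1; p.2] | p in [set p : G * G | adj p.1 p.2]].

Definition complete_adj n : rel 'I_n := fun i j => i != j.

Lemma complete_adj_sym n : symmetric (@complete_adj n).
Proof. by move=> i j; rewrite /complete_adj eq_sym. Qed.

Lemma complete_adj_irrefl n : irreflexive (@complete_adj n).
Proof. by move=> i; rewrite /complete_adj eqxx. Qed.

Definition complete n : sgraph :=
  SGraph (@complete_adj_sym n) (@complete_adj_irrefl n).

Definition path_adj n : rel 'I_n :=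
  fun i j => (i.+1 == j :> nat) || (j.+1 == i :> nat).

Lemma path_adj_sym n : symmetric (@path_adj n).
Proof. by move=> i j; rewrite /path_adj orbC. Qed.

Lemma path_adj_irrefl n : irreflexive (@path_adj n).
Proof. by move=> i; rewrite /path_adj orbb; apply/negbTE; rewrite neq_ltn ltnSn orbT. Qed.

Definition path_graph n : sgraph :=
  SGraph (@path_adj_sym n) (@path_adj_irrefl n).

(* The vertices 0, ..., w - 1 form the clique and w, ..., t - 1 are the pendent
   vertices, all attached to the clique vertex 0. Meaningful for 0 < w < t. *)
Definition pineapple_adj t w : rel 'I_t := fun i j =>
  [|| [&& i != j, i < w & j < w],
      (i == 0 :> nat) && (0 < w <= j) |
      (j == 0 :> nat) && (0 < w <= i)].

Lemma pineapple_adj_sym t w : symmetric (@pineapple_adj t w).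
Proof.
by move=> i j; rewrite /pineapple_adj eq_sym (andbC (i < w)); congr (_ || _); rewrite orbC.
Qed.

Lemma pineapple_adj_irrefl t w : irreflexive (@pineapple_adj t w).
Proof.
move=> i; rewrite /pineapple_adj eqxx orbb /=; case: eqP => // ->.
by case: w.
Qed.

Definition pineapple t w : sgraph :=
  SGraph (@pineapple_adj_sym t w) (@pineapple_adj_irrefl t w).

(* A k-edge-coloring of G is a function c : {set G} -> 'I_k of which only the
   values on [edges G] are ever used. *)
Definition exact_coloring (G : sgraph) k (c : {set G} -> 'I_k) : Prop :=
  forall a : 'I_k, exists2 e, e \in edges G & c e = a.

(* A copy of G in K is given by an isomorphism f from G onto a (not necessarily
   induced) subgraph of K, whose edges are then the f @: e for e in edges G. *)
Definition is_copy (G K : sgraph) (f : G -> K) : Prop :=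
  injective f /\ {homo f : x y / adj x y >-> adj x y}.

Definition has_rainbow_copy (G K : sgraph) k (c : {set K} -> 'I_k) : Prop :=
  exists2 f : G -> K, is_copy f &
    {in edges G &, injective (fun e : {set G} => c (f @: e))}.

Definition has_monochromatic_copy (G K : sgraph) k (c : {set K} -> 'I_k) : Prop :=
  exists2 f : G -> K, is_copy f &
    exists a : 'I_k, {in edges G, forall e : {set G}, c (f @: e) = a}.

Definition gallai_ramsey_bound k (G H : sgraph) (N : nat) : Prop :=
  k <= 'C(N, 2) /\
  forall n, N <= n -> forall c : {set complete n} -> 'I_k, exact_coloring c ->
    has_rainbow_copy G c \/ has_monochromatic_copy H c.

(* gr_k(G : H) = N; a relation, so that the existence of the minimum is part
   of the claim. *)
Definition is_gallai_ramsey k (G H : sgraph) (N : nat) : Prop :=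
  gallai_ramsey_bound k G H N /\
  forall M, gallai_ramsey_bound k G H M -> N <= M.

(* Main.v *)
Require Import Defs.
From mathcomp Require Import all_boot zify.

Set Implicit Arguments.
Unset Strict Implicit.
Unset Printing Implicit Defensive.

(* Upper bound. Say that a color touches another if some vertex is incident to
   both. Four colors on K_n either have a color d such that the other three are
   pairwise non-touching, or two disjoint pairs of touching colors. In the second
   case there is a rainbow star K_{1,4}, fork or paw; an exhaustive search on 7
   vertices shows that, without a rainbow P_5, all edges missing its 5-set of
   vertices have the same color, which gives a monochromatic K_{n-5}. In the
   first case the vertices split into three classes, joined completely in color
   d, each class using d and one color of its own. A d-colored K_5 meeting two
   classes extends to a pineapple, so at most one class has edges of color d, and
   these are triangle-free. The two other classes have at most 6 vertices, and
   the remaining one at most 13 because R(3,5) = 14.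
   Lower bound. Join in color 0 the two-coloring of K_13 given by the cubic
   residues mod 13 and two monochromatic K_6 in colors 2 and 3. *)

(** * Exhaustive search *)

Definition rainbow4 (s : seq nat) (q : nat * nat * nat * nat) :=
  let: (i, j, k, l) := q in uniq [:: nth 0 s i; nth 0 s j; nth 0 s k; nth 0 s l].

(* The colors assigned so far are kept in reverse order, so constraints refer to
   an edge by the number of edges colored after it. The conditional, unlike a
   boolean connective, keeps vm_compute from exploring the pruned branches. *)
Fixpoint search (goal : pred (seq nat)) cs opts (s : seq nat) :=
  match cs, opts with
  | c :: cs', o :: opts' =>
    all (fun a => if has (rainbow4 (a :: s)) c then true
                  else search goal cs' opts' (a :: s)) o
  | _, _ => goal s
  end.

Fixpoint admissible cs (opts : seq (seq nat)) (s w : seq nat) :=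
  match cs, opts, w with
  | c :: cs', o :: opts', a :: w' =>
    [&& a \in o, ~~ has (rainbow4 (a :: s)) c & admissible cs' opts' (a :: s) w']
  | [::], _, [::] => true
  | _, _, _ => false
  end.

Lemma search_sound (goal : pred (seq nat)) cs opts s w :
  search goal cs opts s -> admissible cs opts s w -> goal (catrev w s).
Proof.
elim: cs opts s w => [|c cs IH] [|o opts] s [|a w] //= /allP hs /and3P[ao nc hw].
by move: (hs a ao); rewrite (negbTE nc) => /IH; apply.
Qed.

Definition edge (i j : nat) := if i < j then (i, j) else (j, i).

Definition edges_upto n := flatten [seq [seq (i, j) | i <- iota 0 j] | j <- iota 0 n].

(** With the seed in front, its four edges can be given the colors 0, 1, 2, 3 outright. Since
    [edges_upto] goes by larger endpoint and every seed lives on 0, ..., 4, the edges of that K_5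
    still come first. *)
Definition order (seed : seq (nat * nat)) :=
  seed ++ [seq e <- edges_upto 7 | e \notin seed].

Fixpoint simple_paths n k : seq (seq nat) :=
  if k is k'.+1 then
    flatten [seq [seq x :: p | x <- iota 0 n & x \notin p] | p <- simple_paths n k']
  else [:: [::]].

Lemma simple_pathsP n k p :
  p \in simple_paths n k -> [/\ size p = k, uniq p & all (fun x => x < n) p].
Proof.
elim: k p => [|k IH] p /=; first by rewrite inE => /eqP->.
case/flatten_mapP => q /IH[<- uq aq] /mapP[x]; rewrite mem_filter mem_iota /=.
by case/andP=> xq xn -> /=; rewrite xq uq xn aq.
Qed.

Definition quad (o : seq (nat * nat)) p :=
  if p is [:: a; b; c; d; e] then
    (index (edge a b) o, index (edge b c) o, index (edge c d) o, index (edge d e) o)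
  else (size o, 0, 0, 0).

(** Each path is tested at the time [t] when its last edge is colored; positions become offsets in
    the reversed list of colors. *)
Definition constraints (qs : seq (nat * nat * nat * nat)) t :=
  [seq (let: (i, j, k, l) := q in (t - i, t - j, t - k, t - l)) | q <- qs &
    let: (i, j, k, l) := q in maxn (maxn i j) (maxn k l) == t].

(* The last edge colored joins 5 and 6, and the first ten are those of the K_5 on
   0, ..., 4. *)
Definition decisive (s : seq nat) :=
  if s is a :: _ then all (fun b => (4 <= count_mem b (drop 11 s)) == (b == a)) (iota 0 4)
  else false.

(** Comparing the endpoints keeps one of the two orientations of each path. *)
Definition path_quads o :=
  [seq quad o p | p <- simple_paths 7 5 & head 0 p < last 0 p].

Definition options := [:: [:: 0]; [:: 1]; [:: 2]; [:: 3]] ++ nseq 17 (iota 0 4).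

Definition check seed :=
  let qs := path_quads (order seed) in
  search decisive [seq constraints qs t | t <- iota 0 21] options [::].

(** The star K_{1,4}, the fork and the paw; the paw leaves vertex 4 isolated. *)
Definition seeds :=
  [:: [:: (0, 1); (0, 2); (0, 3); (0, 4)];
      [:: (0, 1); (0, 2); (0, 3); (3, 4)];
      [:: (0, 1); (0, 2); (1, 2); (0, 3)]].

Lemma check_seeds : all check seeds.
Proof. by vm_compute. Qed.

Lemma order_seeds seed : seed \in seeds ->
  [/\ size (order seed) = 21, size seed = 4, last (0, 0) (order seed) = (5, 6)
    & all (fun e => (e.1 < 5) && (e.2 < 5)) (take 10 (order seed))].
Proof.
pose P seed := [&& size (order seed) == 21, size seed == 4,
  last (0, 0) (order seed) == (5, 6) &
  all (fun e => (e.1 < 5) && (e.2 < 5)) (take 10 (order seed))].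
have /allP hP : all P seeds by vm_compute.
by move/hP => /and4P[/eqP-> /eqP-> /eqP-> ->].
Qed.

(** An arbitrary starting time [t] makes the induction on [k] go through; the reversed prefix of
    length [t] is the state of the search. *)
Lemma admissible_drop (opts : seq (seq nat)) (qs : seq (nat * nat * nat * nat))
    (w : seq nat) n t k :
  size opts = n -> size w = n -> t + k = n ->
  (forall u, u < n -> nth 0 w u \in nth [::] opts u) ->
  (forall u, u < n -> ~~ has (rainbow4 (rev (take u.+1 w))) (constraints qs u)) ->
  admissible [seq constraints qs u | u <- iota t k] (drop t opts)
    (rev (take t w)) (drop t w).
Proof.
move=> so sw; elim: k t => [|k IH] t tk ho hc /=.
  by rewrite !drop_oversize //; lia.
have tn : t < n by lia.
rewrite (drop_nth 0) ?sw // (drop_nth [::]) ?so // /=.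
have e : nth 0 w t :: rev (take t w) = rev (take t.+1 w).
  by rewrite (take_nth 0) ?sw // rev_rcons.
by rewrite ho //= e hc //= IH //; lia.
Qed.

(** The count involves only the K_5 on 0, ..., 4, so the colors there determine the color of the
    edge joining 5 and 6. *)
Lemma check_sound seed (g : nat -> nat -> nat) : seed \in seeds ->
  (forall i j, g i j = g j i) ->
  (forall e, e \in order seed -> g e.1 e.2 < 4) ->
  (forall p, p \in simple_paths 7 5 ->
    ~~ uniq (pairmap g (head 0 p) (behead p))) ->
  [seq g e.1 e.2 | e <- seed] = iota 0 4 ->
  forall b, b < 4 ->
    (4 <= count_mem b [seq g e.1 e.2 | e <- take 10 (order seed)]) = (b == g 5 6).
Proof.
move=> hs gsym g4 gfree gseed b b4.
have [so s4 lo _] := order_seeds hs.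
set w := [seq g e.1 e.2 | e <- order seed].
have sw : size w = 21 by rewrite size_map.
have w4 u : u < 21 -> nth 0 w u < 4.
  by move=> u21; rewrite (nth_map (0, 0)) ?so //; apply/g4/mem_nth; rewrite so.
have wseed : take 4 w = iota 0 4 by rewrite -map_take take_size_cat.
have hopt u : u < 21 -> nth 0 w u \in nth [::] options u.
  move=> u21; have [u4|u4] := ltnP u 4.
    by rewrite -(nth_take _ u4) wseed; case: u u21 u4 => [|[|[|[|]]]].
  rewrite nth_cat ifN -?leqNgt // nth_nseq ifT ?mem_iota ?w4 //.
  by rewrite ltn_subLR.
have hedge a c : index (edge a c) (order seed) < 21 ->
    nth 0 w (index (edge a c) (order seed)) = g a c.
  move=> i21; rewrite (nth_map (0, 0)) ?so // nth_index -?index_mem ?so //.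
  by rewrite /edge; case: ifP.
have hcon u : u < 21 ->
    ~~ has (rainbow4 (rev (take u.+1 w))) (constraints (path_quads (order seed)) u).
  move=> u21; apply/hasPn => q /mapP[q']; rewrite mem_filter => /andP[hm].
  case/mapP => p; rewrite mem_filter => /andP[_ hp] eq' ->.
  have:= gfree p hp; have [] := simple_pathsP hp.
  rewrite {}eq' {q'} /quad in hm *.
  case: p {hp} hm => [|x0 [|x1 [|x2 [|x3 [|x4 [|]]]]]] //= hm _ _ _.
  have hn i : i <= u -> nth 0 (rev (take u.+1 w)) (u - i) = nth 0 w i.
    move=> iu; have st : size (take u.+1 w) = u.+1 by rewrite size_takel ?sw.
    rewrite nth_rev st ?ltnS ?leq_subr // subSS subKn //.
    by rewrite nth_take.
  by rewrite !hn ?hedge //; lia.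
have hadm : admissible [seq constraints (path_quads (order seed)) u | u <- iota 0 21]
    options [::] w.
  by have := @admissible_drop options _ w 21 0 21 erefl sw erefl hopt hcon;
    rewrite take0 !drop0.
have := search_sound (allP check_seeds _ hs) hadm; rewrite catrevE cats0.
have ew : w = rcons (take 20 w) (g 5 6).
  have -> : g 5 6 = nth 0 w 20.
    by rewrite (nth_map (0, 0)) ?so // -[20]/(21.-1) -so nth_last lo.
  by rewrite -take_nth ?sw // -sw take_size.
rewrite /decisive.
have -> : rev w = g 5 6 :: rev (take 20 w) by rewrite {1}ew rev_rcons.
have -> : drop 11 (g 5 6 :: rev (take 20 w)) = rev (take 10 w).
  by rewrite -rev_rcons -ew drop_rev sw.
move/allP => /(_ b); rewrite mem_iota /= => /(_ b4) /eqP <-.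
by rewrite count_rev -map_take.
Qed.


(** * Two cherries with four colors *)

Definition hue (T : finType) (c : T -> T -> 'I_4) a x y := (x != y) && (c x y == a).

Definition rainbow_P5_free (T : finType) (c : T -> T -> 'I_4) :=
  forall x p, size p = 4 -> uniq (x :: p) -> ~~ uniq (pairmap c x p).

Definition seed_colors (T : finType) (c : T -> T -> 'I_4) z (xs : seq T)
    (seed : seq (nat * nat)) :=
  [seq c (nth z xs e.1) (nth z xs e.2) | e <- seed].

Lemma mem_uniq4 (s : seq 'I_4) (a : 'I_4) : uniq s -> size s = 4 -> a \in s.
Proof.
move=> us s4; have hsub : {subset s <= enum 'I_4} by move=> x _; rewrite mem_enum.
have hle : size (enum 'I_4) <= size s by rewrite size_enum_ord s4.
by rewrite (uniq_min_size us hsub hle) mem_enum.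
Qed.

(** Renaming colors by their index in [C] gives the seed the colors 0 to 3. By [check_sound] the
    color of an outside pair is then read off from the colors inside [xs] alone. *)
Lemma seed_outside (T : finType) (c : T -> T -> 'I_4) z xs seed :
  (forall x y, c x y = c y x) -> rainbow_P5_free c ->
  seed \in seeds -> size xs = 5 -> uniq xs -> uniq (seed_colors c z xs seed) ->
  forall v w v' w', uniq (v :: w :: xs) -> uniq (v' :: w' :: xs) ->
  c v w = c v' w'.
Proof.
move=> csym cfree hs s5 uxs; set C := seed_colors _ _ _ _ => uC.
have [_ s4 _ o5] := order_seeds hs.
have sC : size C = 4 by rewrite size_map s4.
have memC a : a \in C by exact: mem_uniq4.
pose f v w i := nth z (xs ++ [:: v; w]) i.
pose g v w i j := index (c (f v w i) (f v w j)) C.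
have g4 v w i j : g v w i j < 4 by rewrite -sC index_mem.
have fE v w i : i < 5 -> f v w i = nth z xs i by move=> i5; rewrite /f nth_cat s5 i5.
have fin v w i : i < 7 -> f v w i \in xs ++ [:: v; w].
  by move=> i7; rewrite mem_nth // size_cat s5.
have ufree v w : uniq (v :: w :: xs) -> forall p, p \in simple_paths 7 5 ->
    ~~ uniq (pairmap (g v w) (head 0 p) (behead p)).
  move=> uvw [|x p] /simple_pathsP[] // [sp] up ap.
  have uf : uniq (map (f v w) (x :: p)).
    rewrite map_inj_in_uniq // => i j ix jx /eqP; rewrite nth_uniq => [/eqP //|||].
    - by rewrite size_cat s5; apply: (allP ap _ ix).
    - by rewrite size_cat s5; apply: (allP ap _ jx).
    by rewrite uniq_catC.
  have := cfree _ _ _ uf; rewrite size_map sp => /(_ erefl).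
  suff -> : pairmap (g v w) x p = map (index^~ C) (pairmap c (f v w x) (map (f v w) p)).
    by apply: contra => /map_uniq.
  by elim: (p) (x) => //= y q IH x'; rewrite IH.
have useed v w : [seq g v w e.1 e.2 | e <- seed] = iota 0 4.
  have -> : [seq g v w e.1 e.2 | e <- seed] = map (index^~ C) C.
    rewrite -map_comp; apply/eq_in_map => e es /=.
    have /(allP o5)/andP[e1 e2] : e \in take 10 (order seed).
      by rewrite take_cat s4 mem_cat es.
    by rewrite /g !fE.
  apply: (@eq_from_nth _ 0); first by rewrite size_map size_iota sC.
  rewrite size_map sC => i i4; rewrite (nth_map ord0) ?sC // nth_iota //.
  by rewrite index_uniq ?sC.
have key v w : uniq (v :: w :: xs) -> forall b, b < 4 ->
    (4 <= count_mem b
       [seq index (c (nth z xs e.1) (nth z xs e.2)) C | e <- take 10 (order seed)])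
    = (b == index (c v w) C).
  move=> uvw b b4.
  have gsym i j : g v w i j = g v w j i by rewrite /g csym.
  have := check_sound hs gsym (fun e _ => g4 v w e.1 e.2) (ufree v w uvw) (useed v w) b4.
  rewrite {2}/g /f !nth_cat s5 /= => <-; congr (_ <= count_mem b _).
  by apply/eq_in_map => e /(allP o5)/andP[e1 e2]; rewrite /g !fE.
move=> v w v' w' uvw uvw'.
have b4 : index (c v w) C < 4 by have := memC (c v w); rewrite -index_mem sC.
have := key _ _ uvw' _ b4; rewrite (key _ _ uvw _ b4) eqxx => /esym/eqP e.
by rewrite -(nth_index ord0 (memC (c v w))) e nth_index.
Qed.


Definition seeded (T : finType) (c : T -> T -> 'I_4) :=
  exists seed z xs, [/\ seed \in seeds, size xs = 5, uniq xs &
    uniq (seed_colors c z xs seed)].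

Lemma ex_notin (T : finType) (s : seq T) : size s < #|T| -> exists x, x \notin s.
Proof.
move=> hs; have [x xs|h] := pickP [predC s]; first by exists x.
suff : #|T| <= size s by rewrite leqNgt hs.
rewrite cardT; apply: uniq_leq_size (enum_uniq T) _ => x _.
by have /negbFE := h x.
Qed.

Ltac split_ne :=
  repeat match goal with
  | |- is_true (_ && _) -> _ => case/andP
  | |- is_true true -> _ => move=> _
  | |- is_true (_ != _) -> _ => move=> ?
  end.

Ltac distinct :=
  rewrite /= ?inE ?negb_or ?andbT; repeat (apply/andP; split);
  by [] || by rewrite eq_sym.

(* A rainbow path x v v' followed by y and z at v' is a fork, or a paw when x
   is y or z. *)
Lemma chain_seeded (T : finType) (c : T -> T -> 'I_4) x v v' y z :
  (forall x y, c x y = c y x) -> 4 < #|T| ->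
  x != v -> v != v' -> v' != y -> v' != z ->
  uniq [:: c x v; c v v'; c v' y; c v' z] -> seeded c.
Proof.
move=> csym cardT nxv nvv nvy nvz.
rewrite /= !inE !negb_or !andbT; split_ne.
have nyz : y != z by apply: contraNneq (_ : c v' y != c v' z) => [->|].
have nxv' : x != v' by apply: contraNneq (_ : c x v != c v v') => [->|]; rewrite // csym.
have nvy' : v != y by apply: contraNneq (_ : c v v' != c v' y) => [->|]; rewrite // csym.
have nvz' : v != z by apply: contraNneq (_ : c v v' != c v' z) => [->|]; rewrite // csym.
have [exy|nxy] := eqVneq x y.
  (* The triangle [x v v'] with the pendent edge [v' z] is a paw; [t] fills the list up to five
     vertices. *)
  have [t] := @ex_notin _ [:: v'; v; x; z] cardT.
  rewrite !inE !negb_or; split_ne; subst y.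
  exists [:: (0, 1); (0, 2); (1, 2); (0, 3)], v, [:: v'; v; x; z; t]; split => //.
    distinct.
  rewrite /seed_colors /= (csym v x) (csym v' v); distinct.
have [exz|nxz] := eqVneq x z.
  have [t] := @ex_notin _ [:: v'; v; x; y] cardT.
  rewrite !inE !negb_or; split_ne; subst z.
  exists [:: (0, 1); (0, 2); (1, 2); (0, 3)], v, [:: v'; v; x; y; t]; split => //.
    distinct.
  rewrite /seed_colors /= (csym v x) (csym v' v); distinct.
exists [:: (0, 1); (0, 2); (0, 3); (3, 4)], v, [:: v'; y; z; v; x]; split => //.
  distinct.
rewrite /seed_colors /= (csym v x) (csym v' v); distinct.
Qed.

(** Equal centers give a star. Otherwise the edge [v v'] has one of the four colors; it replaces the
    cherry edge of that color, and the remaining edges form a chain as in [chain_seeded]. *)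
Lemma cherries_seeded (T : finType) (c : T -> T -> 'I_4) v x y v' x' y' :
  (forall x y, c x y = c y x) -> 4 < #|T| ->
  v != x -> v != y -> v' != x' -> v' != y' ->
  uniq [:: c v x; c v y; c v' x'; c v' y'] -> seeded c.
Proof.
move=> csym cardT nvx nvy nvx' nvy' uc.
have [evv|nvv] := eqVneq v v'.
  move: uc; rewrite /= !inE !negb_or !andbT; split_ne; subst v'.
  have ne a b : c v a != c v b -> a != b by apply: contraNneq => ->.
  exists [:: (0, 1); (0, 2); (0, 3); (0, 4)], v, [:: v; x; y; x'; y']; split => //.
    have [? ? ?] : [/\ x != y, x != x' & x != y'] by split; apply: ne.
    have [? ? ?] : [/\ y != x', y != y' & x' != y'] by split; apply: ne.
    distinct.
  by rewrite /seed_colors /=; distinct.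
have := mem_uniq4 (c v v') uc erefl.
move: uc; rewrite /= !inE !negb_or !andbT; split_ne.
case/or4P => /eqP e.
- apply: (@chain_seeded _ _ y v v' x' y') => //; first by rewrite eq_sym.
  by rewrite e (csym y); distinct.
- apply: (@chain_seeded _ _ x v v' x' y') => //; first by rewrite eq_sym.
  by rewrite e (csym x); distinct.
- apply: (@chain_seeded _ _ y' v' v x y); rewrite // 1?eq_sym //.
  by rewrite (csym v' v) e (csym y'); distinct.
- apply: (@chain_seeded _ _ x' v' v x y); rewrite // 1?eq_sym //.
  by rewrite (csym v' v) e (csym x'); distinct.
Qed.


(** * Monochromatic pineapples *)

(** The hub is [x]; the first four entries of [s] complete the K_5 and the last two are the pendent
    vertices. *)
Definition mono_pineapple (T : finType) (c : T -> T -> 'I_4) :=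
  exists a x s, [/\ size s = 6, uniq (x :: s), all (fun y => c x y == a) s &
    pairwise (fun y z => c y z == a) (take 4 s)].

Definition mono_on (T : finType) (c : T -> T -> 'I_4) a (B : {set T}) :=
  {in B &, forall y z, y != z -> c y z = a}.

(** Four further vertices of [B] complete the clique; of the six neighbors of [x] in color [a], at
    least two remain as pendent vertices, inside [B] or not. *)
Lemma pineapple_of_clique (T : finType) (c : T -> T -> 'I_4) a (B : {set T}) x :
  mono_on c a B -> x \in B -> 4 < #|B| -> 5 < #|[set y | hue c a x y]| ->
  mono_pineapple c.
Proof.
move=> mB xB B5 N6; set N := [set y | hue c a x y] in N6.
pose s := take 4 (enum (B :\ x)).
have ss : size s = 4 by rewrite size_takel // -cardE; move: B5; rewrite (cardsD1 x) xB.
have us : uniq s by rewrite take_uniq // enum_uniq.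
have sB y : y \in s -> (y != x) && (y \in B).
  by move=> /mem_take; rewrite mem_enum in_setD1.
pose r := take 2 (enum (N :\: [set y in s])).
have sr : size r = 2.
  rewrite size_takel // -cardE cardsD.
  have : #|N :&: [set y in s]| <= 4.
    rewrite -ss -(card_uniqP us); apply: subset_leq_card.
    by apply/subsetP => y; rewrite !inE => /andP[].
  by move: N6; lia.
have rN y : y \in r -> [/\ y \notin s, x != y & c x y = a].
  by move=> /mem_take; rewrite mem_enum !inE /hue => /and3P[-> -> /eqP].
exists a, x, (s ++ r); split.
- by rewrite size_cat ss sr.
- rewrite /= mem_cat negb_or cat_uniq us take_uniq ?enum_uniq //= andbT -!andbA.
  apply/and3P; split.
  + by apply/negP => /sB; rewrite eqxx.
  + by apply/negP => /rN[_]; rewrite eqxx.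
  + by apply/hasPn => y /rN[].
- apply/allP => y; rewrite mem_cat => /orP[/sB/andP[yx yB]|/rN[_ _ ->] //].
  by rewrite mB // eq_sym.
- rewrite take_size_cat //; apply: (@sub_in_pairwise _ (mem s) (fun y z => y != z)).
  + by move=> y z /sB/andP[_ yB] /sB/andP[_ zB] nyz; rewrite mB.
  + by apply/allP.
  + by rewrite -uniq_pairwise.
Qed.

Lemma pineapple_of_clique7 (T : finType) (c : T -> T -> 'I_4) a (B : {set T}) :
  mono_on c a B -> 6 < #|B| -> mono_pineapple c.
Proof.
move=> mB B7; have [B0|[x xB]] := set_0Vmem B; first by rewrite B0 cards0 in B7.
apply: (pineapple_of_clique mB xB); first by lia.
have B6 : 5 < #|B :\ x| by move: B7; rewrite (cardsD1 x) xB.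
apply: (leq_trans B6); apply: subset_leq_card.
apply/subsetP => y; rewrite !inE /hue => /andP[yx yB].
by rewrite eq_sym yx mB ?eqxx // eq_sym.
Qed.

(** At least 7 vertices lie outside the seed, and all edges among them have one color. *)
Lemma seeded_pineapple (T : finType) (c : T -> T -> 'I_4) :
  (forall x y, c x y = c y x) -> rainbow_P5_free c -> 11 < #|T| -> seeded c ->
  mono_pineapple c.
Proof.
move=> csym cfree cT [seed [z [xs [hs s5 uxs uC]]]].
pose B := ~: [set y in xs].
have B7 : 6 < #|B|.
  by have := cardsC [set y in xs]; rewrite cardsE (card_uniqP uxs) s5 -/B; lia.
have /card_gt1P[v [w [vB wB nvw]]] : 1 < #|B| by lia.
apply: (@pineapple_of_clique7 _ c (c v w) B) B7 => v' w' vB' wB' nvw'.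
apply: (seed_outside csym cfree hs s5 uxs uC); rewrite /= inE negb_or uxs andbT.
  by move: vB' wB'; rewrite !inE nvw' => -> ->.
by move: vB wB; rewrite !inE nvw => -> ->.
Qed.

(** * Colors meeting at a vertex *)

Definition incident (T : finType) (c : T -> T -> 'I_4) p v := [exists x, hue c p v x].

Definition touch (T : finType) (c : T -> T -> 'I_4) p q :=
  [exists v, incident c p v && incident c q v].

Definition surjective_coloring (T : finType) (c : T -> T -> 'I_4) :=
  forall p, exists x y, hue c p x y.

Definition dominant (T : finType) (c : T -> T -> 'I_4) d :=
  forall p q, p != d -> q != d -> p != q -> ~~ touch c p q.

(** Take an edge at [x] of color [p], an edge at [z] of another color [q], and look at [x z]: if its
    color is [p], then [p] touches [q] at [z]; otherwise its color touches [p] at [x]. *)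
Lemma touch_neighbor (T : finType) (c : T -> T -> 'I_4) p :
  (forall x y, c x y = c y x) -> surjective_coloring c -> exists2 q, q != p & touch c p q.
Proof.
move=> csym ce.
have hueC a x y : hue c a x y = hue c a y x by rewrite /hue eq_sym csym.
have [q qp] : exists q : 'I_4, q \notin [:: p] by apply: ex_notin; rewrite card_ord.
rewrite inE in qp.
have [x [y xy]] := ce p; have [z [w zw]] := ce q.
have ix : incident c p x by apply/existsP; exists y.
have iz : incident c q z by apply/existsP; exists w.
have [exz|nxz] := eqVneq x z.
  by exists q => //; apply/existsP; exists x; rewrite ix exz iz.
have [exz|pxz] := eqVneq (c x z) p.
  exists q => //; apply/existsP; exists z; rewrite iz andbT.
  by apply/existsP; exists x; rewrite hueC /hue nxz exz eqxx.
exists (c x z) => //; apply/existsP; exists x; rewrite ix.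
by apply/existsP; exists z; rewrite /hue nxz eqxx.
Qed.

(** By [touch_neighbor], touching is a graph on four colors without isolated vertices. Such a graph
    has a perfect matching or is a star, whose center is the dominant color. *)
Lemma dominant_or_cherries (T : finType) (c : T -> T -> 'I_4) :
  (forall x y, c x y = c y x) -> surjective_coloring c ->
  (exists d, dominant c d) \/
  exists p q r s, [/\ uniq [:: p; q; r; s], touch c p q & touch c r s].
Proof.
move=> csym ce.
have tC p q : touch c p q = touch c q p by apply: eq_existsb => v; rewrite andbC.
have ne p : exists2 q, q != p & touch c p q by apply: touch_neighbor.
pose p : 'I_4 := ord0; have [q qp tpq] := ne p.
have [r] : exists r, r \notin [:: p; q] by apply: ex_notin; rewrite card_ord.
have [s] : exists s, s \notin [:: p; q; r] by apply: ex_notin; rewrite card_ord.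
rewrite !inE !negb_or; split_ne.
have upqrs : uniq [:: p; q; r; s] by distinct.
have [trs|ntrs] := boolP (touch c r s); first by right; exists p, q, r, s.
have [/andP[tpr tqs]|] := boolP (touch c p r && touch c q s).
  by right; exists p, r, q, s; split=> //; distinct.
have [/andP[tps tqr]|] := boolP (touch c p s && touch c q r).
  by right; exists p, s, q, r; split=> //; distinct.
have tr : touch c p r || touch c q r.
  have [x xr] := ne r; have := mem_uniq4 x upqrs erefl; rewrite !inE.
  by case/or4P => /eqP ex; move: xr; rewrite ex ?eqxx ?(negbTE ntrs) // (tC r) => _ ->;
    rewrite ?orbT.
have ts : touch c p s || touch c q s.
  have [x xs] := ne s; have := mem_uniq4 x upqrs erefl; rewrite !inE.
  by case/or4P => /eqP ex; move: xs; rewrite ex ?eqxx // (tC s) ?(negbTE ntrs) // => _ ->;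
    rewrite ?orbT.
have dom d x y z : uniq [:: d; x; y; z] -> ~~ touch c x y -> ~~ touch c x z ->
    ~~ touch c y z -> dominant c d.
  move=> ud nxy nxz nyz i j.
  have := mem_uniq4 i ud erefl; have := mem_uniq4 j ud erefl; rewrite !inE.
  by do 2!case/or4P => /eqP->; rewrite ?eqxx // 1?tC.
move=> nps npr; left.
have [tpr|ntpr] := boolP (touch c p r).
  move: npr ts; rewrite tpr /= => nqs; rewrite (negbTE nqs) orbF => tps.
  by move: nps; rewrite tps /= => nqr; exists p; apply: (@dom p q r s).
move: tr nps; rewrite (negbTE ntpr) /= => ->; rewrite andbT => nps.
by exists q; apply: (@dom q p r s) => //; distinct.
Qed.


(** * Ramsey numbers R(3, k) *)

Definition triangle_free (T : finType) (e : rel T) (A : {set T}) :=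
  {in A & &, forall x y z, e x y -> e x z -> ~~ e y z}.

Definition independent (T : finType) (e : rel T) (B : {set T}) :=
  {in B &, forall x y, ~~ e x y}.

(** This is R(3,k) <= m, stated inside a vertex subset so that it applies to neighborhoods. *)
Definition ramsey3 (k m : nat) := forall (T : finType) (e : rel T) (A : {set T}),
  symmetric e -> irreflexive e -> triangle_free e A -> m <= #|A| ->
  exists B : {set T}, [/\ B \subset A, #|B| = k & independent e B].

Lemma ex_subset_card (T : finType) (A : {set T}) k :
  k <= #|A| -> exists2 B : {set T}, B \subset A & #|B| = k.
Proof.
move=> kA; exists [set x in take k (enum A)].
  by apply/subsetP => x; rewrite inE => /mem_take; rewrite mem_enum.
rewrite cardsE; have /card_uniqP-> := take_uniq k (enum_uniq A).
by rewrite size_takel -?cardE.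
Qed.

Lemma triangle_freeS (T : finType) (e : rel T) (A B : {set T}) :
  A \subset B -> triangle_free e B -> triangle_free e A.
Proof. by move=> /subsetP sAB hB x y z *; apply: (hB x y z) => //; apply: sAB. Qed.

Lemma card_split (T : finType) (e : rel T) (A : {set T}) x : irreflexive e -> x \in A ->
  #|A| = (#|[set y in A | e x y]| + #|[set y in A | (y != x) && ~~ e x y]|).+1.
Proof.
move=> eirr xA; rewrite (cardsD1 x) xA -(cardsID [set y | e x y]); congr (_ + _).+1.
  apply: eq_card => y; rewrite !inE; have [->|_] := eqVneq y x; rewrite /= ?eirr //.
  by rewrite andbF.
by apply: eq_card => y; rewrite !inE; case: (y == x); case: (y \in A); case: (e x y).
Qed.

(** Without triangles the neighborhood of [x] is independent; and [x] can be added to any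
    independent set of non-neighbors. *)
Lemma ramsey3_vertex k m (T : finType) (e : rel T) (A : {set T}) x : ramsey3 k m ->
  symmetric e -> irreflexive e -> triangle_free e A -> x \in A ->
  (k < #|[set y in A | e x y]|) || (m <= #|[set y in A | (y != x) && ~~ e x y]|) ->
  exists B : {set T}, [/\ B \subset A, #|B| = k.+1 & independent e B].
Proof.
move=> hkm esym eirr hA xA /orP[/ex_subset_card[B sB cB]|hm].
  have BA y : y \in B -> (y \in A) && e x y by move/(subsetP sB); rewrite inE.
  exists B; split=> //; first by apply/subsetP => y /BA/andP[].
  by move=> y z /BA/andP[yA xy] /BA/andP[zA xz]; apply: (hA x).
have [|B [sB cB iB]] := hkm T e _ esym eirr _ hm.
  by apply: triangle_freeS hA; apply/subsetP => y; rewrite inE => /andP[].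
have BA y : y \in B -> [/\ y \in A, y != x & ~~ e x y].
  by move/(subsetP sB); rewrite inE => /and3P[].
exists (x |: B); split.
- by rewrite subUset sub1set xA; apply/subsetP => y /BA[].
- by rewrite cardsU1 cB; case: (boolP (x \in B)) => // /BA[_]; rewrite eqxx.
move=> y z /setU1P[->|yB] /setU1P[->|zB]; first by rewrite eirr.
- by have [] := BA z zB.
- by rewrite esym; have [] := BA y yB.
- exact: iB.
Qed.

(** If no alternative of [ramsey3_vertex] held, [x] would have at most [k] neighbors and [m - 1]
    non-neighbors, hence [#|A| <= m + k]. *)
Lemma ramsey3S k m : ramsey3 k m -> ramsey3 k.+1 (m + k.+1).
Proof.
move=> hkm T e A esym eirr hA mA.
have /card_gt0P[x xA] : 0 < #|A| by lia.
by apply: (ramsey3_vertex hkm esym eirr hA xA); have := card_split eirr xA; lia.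
Qed.

Lemma ramsey3_1 : ramsey3 1 1.
Proof.
move=> T e A _ eirr _ /card_gt0P[x xA]; exists [set x]; split.
- by rewrite sub1set.
- by rewrite cards1.
- by move=> y z /set1P-> /set1P->; rewrite eirr.
Qed.

(** [S] counts each edge once, from its endpoint of smaller rank, so the degree sum is [S.*2]. *)
Lemma handshake (T : finType) (e : rel T) (A : {set T}) :
  symmetric e -> irreflexive e -> ~~ odd (\sum_(x in A) #|[set y in A | e x y]|).
Proof.
move=> esym eirr; pose lt (x y : T) := enum_rank x < enum_rank y.
pose S := \sum_(x in A) \sum_(y in A) (lt x y && e x y : nat).
suff -> : \sum_(x in A) #|[set y in A | e x y]| = S.*2 by rewrite odd_double.
rewrite -addnn {2}/S exchange_big -big_split; apply: eq_bigr => x xA /=.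
rewrite -big_split -sum1_card big_mkcond [RHS]big_mkcond; apply: eq_bigr => y _ /=.
rewrite inE (esym y x); case: (y \in A) => //=.
rewrite /lt; case: (ltngtP (enum_rank x) (enum_rank y)) => [||/ord_inj/enum_rank_inj->];
  by rewrite ?eirr //=; case: (e x y).
Qed.

(* If no vertex of a 9-set yields 4 independent vertices then every degree is 3,
   which the handshake lemma excludes. *)
Lemma ramsey3_4 : ramsey3 4 9.
Proof.
move=> T e A0 esym eirr hA0 /ex_subset_card[A sA cA].
have hA := triangle_freeS sA hA0.
have r3 : ramsey3 3 6 by exact: (ramsey3S (ramsey3S ramsey3_1)).
case: (pickP [pred x in A | (3 < #|[set y in A | e x y]|) ||
    (6 <= #|[set y in A | (y != x) && ~~ e x y]|)]) => [x /andP[xA hx]|none].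
  have [B [sB cB iB]] := ramsey3_vertex r3 esym eirr hA xA hx.
  by exists B; split=> //; apply: subset_trans sA.
have := handshake A esym eirr; rewrite (eq_bigr (fun=> 3)) ?sum_nat_const ?cA // => x xA.
by have := none x; have := card_split eirr xA; rewrite /= xA cA /=; lia.
Qed.

Lemma ramsey3_5 : ramsey3 5 14.
Proof. exact: (ramsey3S ramsey3_4). Qed.


(** * Colorings with a dominant color *)

(** A vertex meets at most one color other than [d], and that color is its label. Vertices meeting
    no such color get the arbitrary label [p0]. *)
Lemma dominant_labels (T : finType) (c : T -> T -> 'I_4) d :
  (forall x y, c x y = c y x) -> surjective_coloring c -> dominant c d ->
  exists l : T -> 'I_4, [/\ forall x, l x != d,
    forall x y, x != y -> c x y != d -> c x y = l x &
    forall p, p != d -> exists x, l x = p].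
Proof.
move=> csym ce hd; have [p0] := @ex_notin _ [:: d] (ltac:(by rewrite card_ord)).
rewrite inE => p0d.
pose l x := odflt p0 [pick p | (p != d) && incident c p x].
have lE p x : p != d -> incident c p x -> l x = p.
  move=> pd px; rewrite /l; case: pickP => [q /andP[qd qx]|/(_ p)] /=; last by rewrite pd px.
  have [//|pq] := eqVneq q p; have /negP[] := hd _ _ qd pd pq.
  by apply/existsP; exists x; rewrite qx px.
exists l; split.
- by move=> x; rewrite /l; case: pickP => [p /andP[]|].
- move=> x y nxy nd; rewrite (lE (c x y)) //; apply/existsP; exists y.
  by rewrite /hue nxy eqxx.
- move=> p pd; have [x [y xy]] := ce p; exists x; rewrite (lE p) //.
  by apply/existsP; exists y.
Qed.

Definition class (T : finType) (l : T -> 'I_4) p := [set x | l x == p].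

Lemma pairwise_mono_on (T : finType) (c : T -> T -> 'I_4) a s :
  (forall x y, c x y = c y x) -> pairwise (hue c a) s ->
  mono_on c a [set x in s] /\ #|[set x in s]| = size s.
Proof.
move=> csym; elim: s => [|x s IH] /=.
  split; first by move=> y z; rewrite inE.
  by apply: eq_card0 => y; rewrite inE.
case/andP => /allP xs /IH[ms cs]; split.
  move=> y z; rewrite !inE => /predU1P[->|ys] /predU1P[->|zs] nyz.
  - by rewrite eqxx in nyz.
  - by have /andP[_ /eqP] := xs z zs.
  - by rewrite csym; have /andP[_ /eqP] := xs y ys.
  - by apply: ms; rewrite ?inE.
rewrite set_cons cardsU1 cs inE; case: (boolP (x \in s)) => // /xs.
by rewrite /hue eqxx.
Qed.

Section Dominant.
Variables (T : finType) (c : T -> T -> 'I_4) (d : 'I_4) (l : T -> 'I_4).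
Hypothesis csym : forall x y, c x y = c y x.
Hypothesis lc : forall x y, x != y -> c x y != d -> c x y = l x.

(** A color other than [d] on [x y] would be the label of both ends. *)
Lemma label_hue x y : l x != l y -> hue c d x y.
Proof.
move=> nl; have nxy : x != y by apply: contraNneq nl => ->.
rewrite /hue nxy /=; apply: contraNT nl => nd.
have e : c y x = l y by apply: lc; [rewrite eq_sym | rewrite csym].
by rewrite -(lc nxy nd) -e csym.
Qed.

(** Of two classes met by the clique, the smaller has at most half of the vertices. A clique vertex
    in it is joined in color [d] to everything outside, enough for the pendent vertices. *)
Lemma crossing_clique s x y : 12 < #|T| -> 4 < size s -> pairwise (hue c d) s ->
  x \in s -> y \in s -> l x != l y -> mono_pineapple c.
Proof.
move=> cT s5 hs; have [ms cs] := pairwise_mono_on csym hs.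
wlog xy : x y / #|class l (l x)| <= #|class l (l y)|.
  move=> W xs ys nl; have [le|/ltnW le] := leqP #|class l (l x)| #|class l (l y)|.
    exact: (W x y).
  by apply: (W y x) => //; rewrite eq_sym.
move=> xs ys nl; apply: (pineapple_of_clique (a := d) (x := x) ms); rewrite ?inE ?cs //.
have dis : #|class l (l x) :&: class l (l y)| = 0.
  apply: eq_card0 => z; rewrite !inE; apply/negP => /andP[/eqP zx /eqP zy].
  by rewrite -zx zy eqxx in nl.
have := cardsUI (class l (l x)) (class l (l y)); rewrite dis.
have hU : #|class l (l x) :|: class l (l y)| <= #|T| := max_card _.
have := cardsC (class l (l x)).
suff : #|~: class l (l x)| <= #|[set y0 | hue c d x y0]| by lia.
by apply/subset_leq_card/subsetP => z; rewrite !inE eq_sym; apply: label_hue.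
Qed.

Lemma class_mono p (A : {set T}) : A \subset class l p -> {in A &, forall x y, ~~ hue c d x y} ->
  mono_on c p A.
Proof.
move=> /subsetP sA hA x y xA yA nxy; have := sA x xA; rewrite inE => /eqP <-.
by apply: lc => //; have := hA x y xA yA; rewrite /hue nxy.
Qed.

(** R(3,5) <= 14 gives a K_5 in color [p]. If one of its vertices has 7 neighbors in color [d]
    within the class, these form a K_7 in color [p]; otherwise it has at least 14 - 1 - 6 = 7
    neighbors in color [p]. *)
Lemma triangle_free_class p : triangle_free (hue c d) (class l p) ->
  13 < #|class l p| -> mono_pineapple c.
Proof.
move=> tf c14; have hsym : symmetric (hue c d) by move=> x y; rewrite /hue eq_sym csym.
have hirr : irreflexive (hue c d) by move=> x; rewrite /hue eqxx.
have [B [sB cB iB]] := ramsey3_5 hsym hirr tf c14.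
have /card_gt0P[x xB] : 0 < #|B| by rewrite cB.
have xp := subsetP sB x xB.
have [deg7|deg6] := leqP 7 #|[set y in class l p | hue c d x y]|.
  apply: (pineapple_of_clique7 (a := p) _ deg7); apply: class_mono.
    by apply/subsetP => y; rewrite inE => /andP[].
  by move=> y z; rewrite ![_ \in [set _ in _ | _]]inE => /andP[yp xy] /andP[zp xz]; apply: (tf x).
apply: (pineapple_of_clique (class_mono sB iB) xB); first by rewrite cB.
have := card_split hirr xp.
suff : #|[set y in class l p | (y != x) && ~~ hue c d x y]| <= #|[set y | hue c p x y]|
  by lia.
apply/subset_leq_card/subsetP => y; rewrite !inE => /and3P[_ nyx].
rewrite /hue eq_sym nyx /= => nd; move: xp; rewrite inE => /eqP <-.
by rewrite lc // eq_sym.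
Qed.

End Dominant.

Lemma dominant_pineapple (T : finType) (c : T -> T -> 'I_4) d :
  (forall x y, c x y = c y x) -> surjective_coloring c -> dominant c d -> 25 < #|T| ->
  mono_pineapple c.
Proof.
move=> csym ce hd cT; have [l [ld lc ls]] := dominant_labels csym ce hd.
have lhue := @label_hue _ c d l csym lc.
have cross s x y : 4 < size s -> pairwise (hue c d) s ->
  x \in s -> y \in s -> l x != l y -> mono_pineapple c.
  by apply: (crossing_clique csym lc); lia.
have cr x y i j : l x = i -> l y = j -> i != j -> hue c d x y.
  by move=> <- <-; apply: lhue.
pose edgeless i := [forall x in class l i, forall y in class l i, ~~ hue c d x y].
have edgelessPn i : ~~ edgeless i -> exists x y, [/\ l x = i, l y = i & hue c d x y].
  rewrite negb_forall_in => /exists_inP[x xi]; rewrite negb_forall_in => /exists_inP[y yi].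
  by move: xi yi; rewrite !inE negbK => /eqP xi /eqP yi xy; exists x, y.
(* A [d]-edge in each of two classes and a vertex [z] of the third form a K_5 in color [d]. *)
have two i j k : uniq [:: d; i; j; k] -> ~~ edgeless i -> ~~ edgeless j -> mono_pineapple c.
  rewrite /= !inE !negb_or !andbT; split_ne.
  move=> /edgelessPn[x [x' [xi xi' xx]]] /edgelessPn[y [y' [yj yj' yy]]].
  have [z zk] : exists z, l z = k by apply: ls; rewrite eq_sym.
  apply: (@cross [:: x; x'; y; y'; z] x y); rewrite ?inE ?eqxx ?orbT ?xi ?yj //.
  by rewrite /= xx yy (cr x y i j) ?(cr x y' i j) ?(cr x z i k) ?(cr x' y i j)
    ?(cr x' y' i j) ?(cr x' z i k) ?(cr y z j k) ?(cr y' z j k).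
(* An edgeless class is monochromatic, so 7 vertices suffice there. A [d]-triangle in class [i]
   would extend by [y] and [z] to a crossing K_5. *)
have bound i j k : uniq [:: d; i; j; k] -> edgeless j -> edgeless k -> mono_pineapple c.
  move=> u; have := u; rewrite /= !inE !negb_or !andbT; split_ne.
  have small m : edgeless m -> #|class l m| <= 6 \/ mono_pineapple c.
    move=> h; have [|c7] := leqP #|class l m| 6; [by left | right].
    apply: pineapple_of_clique7 (class_mono lc (subxx _) _) c7 => x y xm ym.
    by have /forall_inP/(_ x xm)/forall_inP/(_ y ym) := h.
  move=> /small[cj|//] /small[ck|//].
  have [y yj] : exists y, l y = j by apply: ls; rewrite eq_sym.
  have [z zk] : exists z, l z = k by apply: ls; rewrite eq_sym.
  have [/exists_inP[x1 h1 /exists_inP[x2 h2 /exists_inP[x3 h3 /and3P[h12 h13 h23]]]]|none] :=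
    boolP [exists x1 in class l i, exists x2 in class l i, exists x3 in class l i,
      [&& hue c d x1 x2, hue c d x1 x3 & hue c d x2 x3]].
    move: h1 h2 h3; rewrite !inE => /eqP h1 /eqP h2 /eqP h3.
    apply: (@cross [:: x1; x2; x3; y; z] x1 y); rewrite ?inE ?eqxx ?orbT ?h1 ?yj //.
    by rewrite /= h12 h13 h23 (cr x1 y i j) ?(cr x2 y i j) ?(cr x3 y i j)
      ?(cr x1 z i k) ?(cr x2 z i k) ?(cr x3 z i k) ?(cr y z j k).
  have [ci|ci] := leqP #|class l i| 13; last first.
    apply: (triangle_free_class csym lc _ ci) => x1 x2 x3 h1 h2 h3 h12 h13; apply: contra none => h23.
    apply/exists_inP; exists x1 => //; apply/exists_inP; exists x2 => //.
    by apply/exists_inP; exists x3 => //; rewrite h12 h13 h23.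
  (* The classes cover [T], which would leave at most 13 + 6 + 6 = 25 vertices. *)
  have : #|T| <= #|class l i :|: class l j :|: class l k|.
    rewrite -cardsT; apply/subset_leq_card/subsetP => x _; rewrite !inE.
    have := mem_uniq4 (l x) u erefl; rewrite !inE (negbTE (ld x)) /=.
    by rewrite orbA.
  have := (leq_card_setU (class l i :|: class l j) (class l k)).1.
  by have := (leq_card_setU (class l i) (class l j)).1; lia.
have [p] := @ex_notin _ [:: d] (ltac:(by rewrite card_ord)).
have [q] := @ex_notin _ [:: d; p] (ltac:(by rewrite card_ord)).
have [r] := @ex_notin _ [:: d; p; q] (ltac:(by rewrite card_ord)).
rewrite !inE !negb_or; split_ne.
(* Of the three classes, two are edgeless, so [bound] applies, or two are not, so [two] applies. *)
have u1 : uniq [:: d; p; q; r] by distinct.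
have u2 : uniq [:: d; q; p; r] by distinct.
have u3 : uniq [:: d; r; p; q] by distinct.
have u4 : uniq [:: d; q; r; p] by distinct.
have u5 : uniq [:: d; p; r; q] by distinct.
have [hp|hp] := boolP (edgeless p); have [hq|hq] := boolP (edgeless q);
  have [hr|hr] := boolP (edgeless r);
  solve [exact: (bound _ _ _ u1) | exact: (bound _ _ _ u2) | exact: (bound _ _ _ u3)
  | exact: (two _ _ _ u1) | exact: (two _ _ _ u4) | exact: (two _ _ _ u5)].
Qed.


(** * Rainbow-P_5-free colorings on at least 26 vertices *)

Lemma rainbow_P5_free_pineapple (T : finType) (c : T -> T -> 'I_4) :
  (forall x y, c x y = c y x) -> surjective_coloring c -> rainbow_P5_free c -> 25 < #|T| ->
  mono_pineapple c.
Proof.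
move=> csym ce cfree cT.
have [[d hd]|[p [q [r [s [u]]]]]] := dominant_or_cherries csym ce.
  exact: dominant_pineapple hd cT.
case/existsP => v /andP[/existsP[x /andP[nx /eqP ex]] /existsP[y /andP[ny /eqP ey]]].
case/existsP => v' /andP[/existsP[x' /andP[nx' /eqP ex']] /existsP[y' /andP[ny' /eqP ey']]].
apply: seeded_pineapple => //; first by lia.
by apply: (@cherries_seeded _ _ v x y v' x' y'); rewrite ?ex ?ey ?ex' ?ey' //; lia.
Qed.

(** * Copies *)

Lemma mem_edges (G : sgraph) (x y : G) : adj x y -> [set x; y] \in edges G.
Proof. by move=> xy; apply/imsetP; exists (x, y); rewrite ?inE. Qed.

Lemma edgesP (G : sgraph) (e : {set G}) :
  reflect (exists x y, adj x y /\ e = [set x; y]) (e \in edges G).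
Proof.
apply: (iffP imsetP) => [[[x y]]|[x [y [xy ->]]]]; first by rewrite inE => xy ->; exists x, y.
by exists (x, y); rewrite ?inE.
Qed.

Lemma imset_edge (G K : sgraph) (f : G -> K) x y : f @: [set x; y] = [set f x; f y].
Proof. by rewrite imsetU1 imset_set1. Qed.

Lemma path_edgesP n (e : {set path_graph n}) : e \in edges (path_graph n) ->
  exists i j : 'I_n, j = i.+1 :> nat /\ e = [set i; j].
Proof.
case/edgesP => i [j [/orP[/eqP ij|/eqP ji] ->]]; first by exists i, j.
by exists j, i; rewrite setUC.
Qed.

Definition pair_color n (c : {set complete n} -> 'I_4) (x y : 'I_n) := c [set x; y].

Lemma has_rainbow_P5 n (c : {set complete n} -> 'I_4) x p :
  size p = 4 -> uniq (x :: p) -> uniq (pairmap (pair_color c) x p) ->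
  has_rainbow_copy (path_graph 5) c.
Proof.
move=> sp ux up; pose f (i : path_graph 5) : complete n := nth x (x :: p) (i : 'I_5).
have finj : injective f.
  move=> i j /eqP; rewrite nth_uniq ?(ltn_ord (i : 'I_5)) ?(ltn_ord (j : 'I_5)) //=; last first.
  - by rewrite sp (ltn_ord (j : 'I_5)).
  - by rewrite sp (ltn_ord (i : 'I_5)).
  by move/eqP/val_inj.
exists f; first split=> // i j ij.
  by rewrite /= /complete_adj (inj_eq finj); apply: contraTneq ij => ->; rewrite adj_irrefl.
have col (i j : 'I_5) : j = i.+1 :> nat ->
    i < 4 /\ c (f @: [set i; j]) = nth ord0 (pairmap (pair_color c) x p) i.
  move=> ij; have i4 : i < 4 by rewrite -ltnS -ij.
  by split=> //; rewrite imset_edge (nth_pairmap x) ?sp // /f ij.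
move=> _ _ /path_edgesP[i [j [ij ->]]] /path_edgesP[i' [j' [ij' ->]]].
have [i4 ->] := col i j ij; have [i4' ->] := col i' j' ij'.
move/eqP; rewrite nth_uniq ?size_pairmap ?sp // => /eqP ei.
by congr [set _; _]; apply: val_inj; rewrite /= ?ij ?ij' ei.
Qed.

Lemma has_mono_pineapple n (c : {set complete n} -> 'I_4) :
  mono_pineapple (pair_color c) -> has_monochromatic_copy (pineapple 7 5) c.
Proof.
case=> a [x [s [ss us /allP sa /pairwiseP pa]]].
pose f (i : pineapple 7 5) : complete n := nth x (x :: s) (i : 'I_7).
have finj : injective f.
  move=> i j /eqP; rewrite nth_uniq //=; last first.
  - by rewrite ss (ltn_ord (j : 'I_7)).
  - by rewrite ss (ltn_ord (i : 'I_7)).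
  by move/eqP/val_inj.
have center (j : 'I_7) : 0 < j -> c [set x; f j] = a.
  rewrite /f; case: j => -[|j] //= hj _; apply/eqP/(sa (nth x s j)).
  by rewrite mem_nth // ss.
have clique (i j : 'I_7) : 0 < i -> i < j -> j < 5 -> c [set f i; f j] = a.
  rewrite /f; case: i j => -[|i] hi [[|j] hj] //= _ ij j5; apply/eqP.
  (* Past the hub, positions in [x :: s] shift down by one, so clique vertices below 5 land in
     [take 4 s]. *)
  rewrite -(nth_take x (n0 := 4)); last by lia.
  rewrite -[nth x s j](nth_take x (n0 := 4)); last by lia.
  by apply: (pa x) => //; rewrite ?inE ?size_takel ?ss //; lia.
exists f; first split=> // i j ij.
  by rewrite /= /complete_adj (inj_eq finj); apply: contraTneq ij => ->; rewrite adj_irrefl.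
exists a => _ /edgesP[i [j [ij ->]]]; rewrite imset_edge.
wlog lij : i j ij / (i : 'I_7) < (j : 'I_7).
  move=> W; have [lij|lji|/val_inj eij] := ltngtP (i : 'I_7) (j : 'I_7).
  - exact: W.
  - by rewrite setUC; apply: W => //; rewrite adj_sym.
  - by move: ij; rewrite eij adj_irrefl.
have [i0|i0] := posnP (i : 'I_7); last first.
  apply: clique => //; case/or3P: ij => [/and3P[]//|/andP[]|/andP[]]; lia.
have -> : f i = x by rewrite /f i0.
by apply: center; apply: leq_ltn_trans lij.
Qed.

Lemma gallai_ramsey_26 n (c : {set complete n} -> 'I_4) : 25 < n -> exact_coloring c ->
  has_rainbow_copy (path_graph 5) c \/ has_monochromatic_copy (pineapple 7 5) c.
Proof.
(* Paths are 5-tuples, a finite type, so [pickP] decides whether a rainbow one exists. *)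
move=> n26 ce; pose P (t : 5.-tuple 'I_n) :=
  if val t is x :: p then uniq (x :: p) && uniq (pairmap (pair_color c) x p) else false.
have [t Pt|none] := pickP P.
  left; case: t Pt => -[|x p] //= sp /andP[ux up].
  by apply: has_rainbow_P5 ux up; move/eqP: sp => [].
right; apply: has_mono_pineapple; apply: rainbow_P5_free_pineapple.
- by move=> x y; rewrite /pair_color setUC.
- move=> a; have [_ /edgesP[x [y [xy ->]]] <-] := ce a.
  by exists x, y; rewrite /hue eqxx andbT.
- move=> x p sp ux; apply/negP => up.
  have st : size (x :: p) == 5 by rewrite /= sp.
  by have /negP[] := none (Tuple st); rewrite /P /=; move: ux => /= ->.
- by rewrite card_ord.
Qed.


(** * A coloring of K_25 *)

(** Blocks of 13, 6 and 6 vertices; the number of a block is also its inner color. *)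
Definition block x := if x < 13 then 1 else if x < 19 then 2 else 3.

(** The nonzero cubes mod 13 are 1, 5, 8, 12; adding 13 guards against truncated subtraction. This
    graph witnesses R(3,5) > 13. *)
Definition cubic13 x y := (x + 13 - y) %% 13 \in [:: 1; 5; 8; 12].

Definition color25 x y :=
  if block x == block y then if (x < 13) && cubic13 x y then 0 else block x else 0.

Definition coloring25 (e : {set complete 25}) : 'I_4 :=
  if enum e is [:: x; y] then inord (color25 (x : 'I_25) (y : 'I_25)) else ord0.

Lemma color25C (x y : 'I_25) : color25 x y = color25 y x.
Proof.
have /allP h : all (fun i => all (fun j => color25 i j == color25 j i) (iota 0 25)) (iota 0 25).
  by vm_compute.
have ord25 (z : 'I_25) : (z : nat) \in iota 0 25 by rewrite mem_iota ltn_ord.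
by apply/eqP; have /allP h' := h x (ord25 x); apply: h' (ord25 y).
Qed.

Lemma color25_lt x y : color25 x y < 4.
Proof. by rewrite /color25 /block; do !case: ifP. Qed.

Lemma color25_block x y : color25 x y != 0 -> color25 x y = block x /\ block y = block x.
Proof. by rewrite /color25; have [->|//] := eqVneq (block x) (block y); case: (_ && _). Qed.

Lemma coloring25E (x y : 'I_25) : x != y -> coloring25 [set x; y] = color25 x y :> nat.
Proof.
move=> nxy; rewrite /coloring25.
have pe : perm_eq (enum [set x; y]) [:: x; y].
  apply: uniq_perm; rewrite ?enum_uniq //= ?inE ?nxy // => z.
  by rewrite mem_enum !inE.
move: (perm_mem pe) (perm_size pe) (enum_uniq [set x; y]).
case: (enum _) => [|u [|v [|w s]]] // pm _ uu.
have := pm u; have := pm v; rewrite !inE !eqxx !orbT /=.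
move: uu; rewrite /= inE andbT => nuv /esym/orP[] /eqP ev /esym/orP[] /eqP eu.
- by rewrite ev eu eqxx in nuv.
- by rewrite inordK ?color25_lt // ev eu color25C.
- by rewrite inordK ?color25_lt // ev eu.
- by rewrite ev eu eqxx in nuv.
Qed.

Lemma coloring25_exact : exact_coloring coloring25.
Proof.
have ex (x y : 'I_25) (a : 'I_4) : x != y -> color25 x y = a ->
    exists2 e, e \in edges (complete 25) & coloring25 e = a.
  move=> nxy cxy; exists [set x; y]; first exact: (mem_edges (G := complete 25)).
  by apply: val_inj; rewrite /= coloring25E.
case=> -[|[|[|[|//]]]] a4.
(* The differences -1 = 12 and -2 = 11 mod 13 are respectively a cube and a non-cube. *)
- by apply: (ex (inord 0) (inord 1)); rewrite -?val_eqE /= ?inordK.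
- by apply: (ex (inord 0) (inord 2)); rewrite -?val_eqE /= ?inordK.
- by apply: (ex (inord 13) (inord 14)); rewrite -?val_eqE /= ?inordK.
- by apply: (ex (inord 19) (inord 20)); rewrite -?val_eqE /= ?inordK.
Qed.

(* Two edges sharing a vertex never have different nonzero colors, so among the
   first two edges of a rainbow P_5, as among the last two, one has color 0. *)
Lemma coloring25_no_rainbow : ~ has_rainbow_copy (path_graph 5) coloring25.
Proof.
case=> f [finj fhom] frain.
pose v i : 'I_25 := f (inord i : 'I_5).
pose k i := color25 (v i) (v i.+1).
have vne i : i < 4 -> v i != v i.+1.
  move=> i4; apply/eqP => /finj /(congr1 val); rewrite /= !inordK //; lia.
have adjv i : i < 4 -> adj (inord i : path_graph 5) (inord i.+1 : path_graph 5).
  by move=> i4; apply/orP; left; rewrite !inordK //; lia.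
have kinj i j : i < j -> j < 4 -> k i != k j.
  move=> ij j4; have i4 : i < 4 by lia.
  apply/negP => /eqP kij.
  have := frain _ _ (mem_edges (adjv i i4)) (mem_edges (adjv j j4)).
  rewrite !imset_edge => /(_ _)/setP.
  have ecol : coloring25 [set v i; v i.+1] = coloring25 [set v j; v j.+1].
    by apply: val_inj; rewrite /= !coloring25E ?vne.
  move/(_ ecol (inord i : 'I_5)); rewrite !inE eqxx /= -!val_eqE /= !inordK; lia.
have step i : k i != 0 -> k i.+1 != 0 -> k i = k i.+1.
  by move=> /color25_block[e1 e2] /color25_block[e3 _]; rewrite /k e1 e3 e2.
move: (step 0) (step 2) (kinj 0 1) (kinj 0 2) (kinj 0 3) (kinj 1 2) (kinj 1 3) (kinj 2 3).
lia.
Qed.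

(** The base case is [false] because the empty clique always exists. *)
Fixpoint clique_free (r : rel nat) k s :=
  if k is k'.+1 then all (fun x => clique_free r k' [seq y <- s | r x y]) s else false.

Lemma clique_freeP (r : rel nat) k s t :
  clique_free r k s -> size t = k -> pairwise r t -> {subset t <= s} -> False.
Proof.
elim: k s t => //= k IH s [//|x t] /allP hs [st] /andP[/allP xt pt] sub.
apply: (IH _ _ (hs x (sub x _)) st pt) => [|y yt]; first exact: mem_head.
by rewrite mem_filter xt //= sub // inE yt orbT.
Qed.

(** Cliques in color 0 have at most 2 + 1 + 1 vertices, and the cubic residue graph has no 5
    independent vertices. Requiring [x < y] lists each clique once. *)
Lemma color25_clique_free a : a < 2 ->
  clique_free (fun x y => (x < y) && (color25 x y == a)) 5 (iota 0 25).
Proof. by case: a => [|[|]] // _; vm_compute. Qed.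

Lemma coloring25_no_pineapple : ~ has_monochromatic_copy (pineapple 7 5) coloring25.
Proof.
case=> f [finj fhom] [a mono].
pose v i : 'I_25 := f (inord i : 'I_7).
have vinj : {in gtn 7 &, injective v}.
  by move=> i j i7 j7 /finj/(congr1 val); rewrite /= !inordK.
have col i j : i < 7 -> j < 7 -> i != j ->
    (i == 0) || (i < 5) && (j < 5) -> color25 (v i) (v j) = a.
  move=> i7 j7 nij h.
  rewrite -coloring25E; last by apply: contraNneq nij => /vinj->.
  rewrite -(imset_edge f (inord i : 'I_7) (inord j : 'I_7)) mono //; apply: mem_edges.
  rewrite /= /pineapple_adj -val_eqE /= !inordK //; move: h; lia.
have umap k : k <= 7 -> uniq [seq val (v i) | i <- iota 0 k].
  move=> k7; rewrite map_inj_in_uniq ?iota_uniq // => i j.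
  by rewrite !mem_iota => ik jk /val_inj/vinj; apply; rewrite inE; lia.
have [a2|a2] := ltnP a 2; last first.
  (* The hub [v 0] is joined to the other vertices in the nonzero color [a], so all seven lie in
     block [a], which has only six vertices. *)
  have vb i : i < 7 -> block (v i) = a.
    move=> i7; have [->|i0] := posnP i.
      by have := col 0 1 isT isT isT isT => c01; have [|<- _] := @color25_block (v 0) (v 1);
        rewrite c01 //; lia.
    have c0i : color25 (v 0) (v i) = a by apply: col => //; lia.
    by have [|<- ->] := @color25_block (v 0) (v i); rewrite c0i //; lia.
  have sub : {subset [seq val (v i) | i <- iota 0 7] <= iota (if a == 2 :> nat then 13 else 19) 6}.
    move=> y /mapP[i]; rewrite !mem_iota => /vb hb ->.
    by move: hb (ltn_ord (v i)) (ltn_ord a) a2; rewrite /block /=;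
      case: (ltnP (v i) 13); case: (ltnP (v i) 19); case: eqP; lia.
  by have := uniq_leq_size (umap 7 (leqnn _)) sub; rewrite size_map !size_iota.
(* Only increasing cliques are listed, so the five clique vertices are sorted first. *)
apply: (clique_freeP (color25_clique_free a2) (t := sort leq [seq val (v i) | i <- iota 0 5])).
- by rewrite size_sort size_map.
- rewrite (pairwise_relI ltn (fun x y => color25 x y == a)); apply/andP; split.
    rewrite -(sorted_pairwise ltn_trans) ltn_sorted_uniq_leq sort_uniq umap //=.
    exact: sort_sorted leq_total _.
  apply: (@sub_in_pairwise _ (mem [seq val (v i) | i <- iota 0 5]) (fun y z => y != z)).
  + move=> y z /mapP[i i5 ->] /mapP[j j5 ->] nij; move: i5 j5; rewrite !mem_iota => i5 j5.
    have nij' : i != j by apply: contraNneq nij => ->.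
    by apply/eqP/col; lia.
  + by apply/allP => y; rewrite mem_sort.
  + by rewrite -uniq_pairwise sort_uniq umap.
- move=> y; rewrite mem_sort => /mapP[i _ ->].
  by rewrite mem_iota /= ltn_ord.
Qed.

Theorem theorem4p4 :
  is_gallai_ramsey 4 (path_graph 5) (pineapple 7 5) 26.
Proof.
split; first by split=> // n n26 c; apply: gallai_ramsey_26.
move=> M [_ hM]; rewrite leqNgt; apply/negP => M26.
(* A bound below 26 covers every larger order, in particular 25. *)
have [] := hM 25 M26 _ coloring25_exact.
- exact: coloring25_no_rainbow.
- exact: coloring25_no_pineapple.
Qed.
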